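(* Let $R$ be a $\ast$-ring. The following statements are equivalent: (1) $R$ is reversible. (2) For all $a,b\in R$, $ab\in E(R)$ implies $ab=ba$. (3) For all $a,b\in R$, $ab\in P(R)$ implies $ab=ba$. (4) For all $a,b\in R$, $ab\in P(R)$ implies $ba\in P(R)$.
   Context: All rings are associative with unity. A $\ast$-ring is a ring $R$ equipped with an involution $\ast$, i.e. a map $\ast:R\to R$ with $(x+y)^{\ast}=x^{\ast}+y^{\ast}$, $(xy)^{\ast}=y^{\ast}x^{\ast}$ and $(x^{\ast})^{\ast}=x$ for all $x,y\in R$. A ring $R$ is reversible if for all $a,b\in R$, $ab=0$ implies $ba=0$. $E(R)$ is the set of idempotents of $R$. $P(R)$ is the set of projections of $R$, i.e. elements $p$ with $p=p^{2}=p^{\ast}$. *)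

(* Defs.v *)
From HB Require Import structures.
From mathcomp Require Import all_boot all_algebra.
Set Implicit Arguments.
Unset Strict Implicit.
Unset Printing Implicit Defensive.

Import GRing.Theory.
Local Open Scope ring_scope.

(* The base structure is pzRingType, not nzRingType, so that the zero ring is
   allowed. *)
HB.mixin Record PzRing_isStarRing R of GRing.PzRing R := {
  star : R -> R;
  starD : forall x y : R, star (x + y) = star x + star y;
  starM : forall x y : R, star (x * y) = star y * star x;
  starK : forall x : R, star (star x) = x
}.

#[short(type="starRingType")]
HB.structure Definition StarRing :=
  { R of GRing.PzRing R & PzRing_isStarRing R }.

Definition reversible (R : pzRingType) : Prop :=
  forall a b : R, a * b = 0 -> b * a = 0.

Definition is_idempotent (R : pzRingType) (e : R) : Prop := e ^+ 2 = e.

Definition is_projection (R : starRingType) (p : R) : Prop :=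
  p = p ^+ 2 /\ p ^+ 2 = star p.

(* Main.v *)
Require Import Defs.
From HB Require Import structures.
From mathcomp Require Import all_boot all_algebra.

Import GRing.Theory.
Local Open Scope ring_scope.

(** The conditions on products [a b] weaken step by step, since a projection is
    idempotent and a product equal to a projection may be replaced by it; the
    content lies at the two ends of the cycle.

    Reversibility makes every idempotent central
    ([reversible_idempotent_central]).  If [e = a b] is idempotent, then so is
    [f = b a], and two central idempotents that factor as [a b] and [b a] absorb
    each other, hence coincide ([reversible_idempotent_mulC]).

    Conversely, [0] is a projection ([is_projection0]), so if [a b = 0] then
    [b a] is a projection, in particular an idempotent; but
    [(b a)^2 = b (a b) a = 0]. *)

(** [e] and [1 - e] annihilate each other, and reversibility lets an arbitrary
    [x] slip between them: both corners [e x (1 - e)] and [(1 - e) x e] vanish,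
    so [e x] and [x e] are both equal to [e x e]. *)
Lemma reversible_idempotent_central (R : pzRingType) (e : R) :
  reversible R -> is_idempotent e -> forall x : R, e * x = x * e.
Proof.
move=> revR; rewrite /is_idempotent expr2 => ee x.
have exe : e * x * (1 - e) = 0.
  by apply: revR; rewrite mulrA mulrBl mul1r ee subrr mul0r.
have xee : (1 - e) * (x * e) = 0.
  by apply: revR; rewrite -mulrA mulrBr mulr1 ee subrr mulr0.
move/eqP: exe; rewrite mulrBr mulr1 subr_eq0 => /eqP ->.
by move/eqP: xee; rewrite mulrBl mul1r subr_eq0 mulrA => /eqP <-.
Qed.

(** Put [e = a b] and [f = b a].  Reversing [a (b (1 - e)) = 0] gives
    [f = b e a], which is [f^2]; so [e] and [f] are both central idempotents.
    Then [f = b e a = e f] and [e = a b a b = a f b = e f]. *)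
Lemma reversible_idempotent_mulC (R : pzRingType) (a b : R) :
  reversible R -> is_idempotent (a * b) -> a * b = b * a.
Proof.
move=> revR idab.
have centralab := reversible_idempotent_central _ _ revR idab.
move: (idab); rewrite /is_idempotent expr2 => abab.
have baE : b * a = b * (a * b) * a.
  apply/eqP; rewrite -subr_eq0 -mulrBl -{1}[b]mulr1 -mulrBr; apply/eqP.
  by apply: revR; rewrite mulrA mulrBr mulr1 abab subrr.
have idba : is_idempotent (b * a).
  by rewrite /is_idempotent expr2 {3}baE !mulrA.
have centralba := reversible_idempotent_central _ _ revR idba.
have -> : b * a = a * b * (b * a) by rewrite {1}baE -centralab -mulrA.
by rewrite -{1}abab -mulrA [b * _]mulrA [b * a * b]centralba mulrA.
Qed.

Lemma is_projection0 (R : starRingType) : is_projection (0 : R).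
Proof.
have star0 : star (0 : R) = 0.
  by apply: (addrI (star 0)); rewrite -starD !addr0.
by rewrite /is_projection expr2 mulr0 star0.
Qed.

Theorem lemma3p1 (R : starRingType) :
  [<-> reversible R;
       forall a b : R, is_idempotent (a * b) -> a * b = b * a;
       forall a b : R, is_projection (a * b) -> a * b = b * a;
       forall a b : R, is_projection (a * b) -> is_projection (b * a)].
Proof.
tfae=> [revR a b|idC a b [/esym idab _]|projC a b projab|projba a b ab0].
- exact: reversible_idempotent_mulC.
- exact: idC.
- by rewrite -projC.
- have [|-> _] := projba a b; first by rewrite ab0; apply: is_projection0.
  by rewrite expr2 mulrA -(mulrA b) ab0 mulr0 mul0r.
Qed.
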